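(* Let $f_1,\dots,f_s\in\mathbb{Q}[x_1,\dots,x_n]$ and let $X=V_{\mathbb{R}}(f_1,\dots,f_s)\subseteq\mathbb{R}^n$ be a real algebraic manifold. Then the reach $\tau(X)$ of $X$ is an algebraic number over $\mathbb{Q}$.
   Context: $V_{\mathbb{R}}(f_1,\dots,f_s)$ is the set of common real zeros of $f_1,\dots,f_s$. The medial axis of $X$ is the set $M_X$ of all points $u\in\mathbb{R}^n$ such that the minimum Euclidean distance from $X$ to $u$ is attained by at least two distinct points in $X$. The reach $\tau(X)$ is the shortest distance (infimum) between any point in the manifold $X$ and any point in its medial axis $M_X$.
   Formalization: The medial axis of X is assumed to be nonempty; when it is empty (for example when X is a line or another affine subspace) the reach is an infimum over the empty set, hence infinite and not an algebraic number. *)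

(* Defs.v *)
From HB Require Import structures.
From mathcomp Require Import all_boot all_order all_algebra.
From mathcomp Require Import all_classical all_reals all_analysis.
From mathcomp Require mpoly.

Set Implicit Arguments.
Unset Strict Implicit.
Unset Printing Implicit Defensive.

Import Order.TTheory GRing.Theory Num.Theory.
Import numFieldNormedType.Exports.

Local Open Scope classical_set_scope.
Local Open Scope ring_scope.

(* The variables 'X_i of a polynomial stand for the coordinates [x 0 i] of a
   row vector [x]. *)
Definition real_zeros (R : realType) (n s : nat)
    (f : 'I_s -> mpoly.mpoly n rat) : set 'rV[R]_n :=
  [set x | forall i : 'I_s,
     mpoly.meval (fun j : 'I_n => x 0 j) (mpoly.map_mpoly ratr (f i)) = 0].
Arguments real_zeros R {n s} f.

(* The library norm on ['rV[R]_n] is the sup norm, hence this definition. *)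
Definition edist (R : realType) (n : nat) (x y : 'rV[R]_n) : R :=
  Num.sqrt (\sum_(i < n) (x 0 i - y 0 i) ^+ 2).

Definition nearest_point (R : realType) (n : nat) (X : set 'rV[R]_n)
    (u x : 'rV[R]_n) : Prop :=
  X x /\ forall z, X z -> edist x u <= edist z u.

Definition medial_axis (R : realType) (n : nat) (X : set 'rV[R]_n) :
    set 'rV[R]_n :=
  [set u | exists x y : 'rV[R]_n,
     [/\ x <> y, nearest_point X u x & nearest_point X u y]].

(* Extended-real infimum: the reach is [+oo] when the medial axis is empty. *)
Definition reach (R : realType) (n : nat) (X : set 'rV[R]_n) : \bar R :=
  ereal_inf [set d | exists x u : 'rV[R]_n,
     [/\ X x, medial_axis X u & d = (edist x u)%:E]].

(* [C_on k U f], for [U] open: [f] is of class C^k on [U].  In finite dimension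
   it is enough to ask this of the derivatives along each fixed vector. *)
Fixpoint C_on (R : realType) (V W : normedModType R) (k : nat) (U : set V)
    (f : V -> W) : Prop :=
  match k with
  | 0 => forall x, U x -> {for x, continuous f}
  | k'.+1 => (forall x, U x -> differentiable f x) /\
             (forall v : V, C_on k' U (fun x => 'D_v f x))
  end.

Definition smooth_on (R : realType) (V W : normedModType R) (U : set V)
    (f : V -> W) : Prop := forall k : nat, C_on k U f.

(* Embedded C^oo submanifold of R^n: near each of its points [p], [X] is the
   zero set of a smooth map to R^c that is a submersion at [p], [c] being the
   codimension of [X] at [p].  Connected components of different dimensions
   are allowed. *)
Definition is_submanifold (R : realType) (n : nat) (X : set 'rV[R]_n) : Prop :=
  forall p, X p ->
    exists (c : nat) (U : set 'rV[R]_n) (g : 'rV[R]_n -> 'rV[R]_c),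
      [/\ open U /\ U p,
          smooth_on U g,
          \rank (jacobian g p) = c &
          X `&` U = [set x | g x = 0] `&` U].

(* Main.v *)
Require Import Defs.
From mathcomp Require Import all_boot all_order all_algebra.
From mathcomp Require Import all_classical all_reals all_analysis.
From mathcomp Require mpoly.
From mathcomp Require Import qe_rcf_th ordered_qelim qe_rcf lra.

(* The set A of the distances between a point of X and a point of its medial axis
   is first-order definable over the rationals in the ordered field R, and the
   reach is its infimum.  Quantifier elimination for real closed fields introduces
   rational constants only, so A is a Boolean combination of sign conditions on
   rational polynomials in one variable.  These signs are constant near a
   transcendental number t, hence so is the membership in A: t has a neighbourhood
   contained in A or disjoint from A, and it cannot be the infimum of A. *)

Set Implicit Arguments.
Unset Strict Implicit.
Unset Printing Implicit Defensive.

Import (canonicals) ord.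
Import (canonicals) mpoly.
Import Order.TTheory GRing.Theory Num.Theory.
Import numFieldNormedType.Exports.

Local Open Scope classical_set_scope.
Local Open Scope ring_scope.

(** * Constants in quantifier elimination *)

Section ConstantsIn.

Variables (F : realFieldType) (S : {pred F}).

Fixpoint term_over (t : GRing.term F) : bool :=
  match t with
  | GRing.Const x => x \in S
  | GRing.Add u v | GRing.Mul u v => term_over u && term_over v
  | GRing.Opp u | GRing.NatMul u _ | GRing.Inv u | GRing.Exp u _ => term_over u
  | _ => true
  end.

Fixpoint formula_over (f : ord.formula F) : bool :=
  match f with
  | ord.Bool _ => true
  | ord.Equal u v | ord.Lt u v | ord.Le u v => term_over u && term_over v
  | ord.Unit u => term_over u
  | ord.And f g | ord.Or f g | ord.Implies f g =>
      formula_over f && formula_over g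
  | ord.Not f | ord.Exists _ f | ord.Forall _ f => formula_over f
  end.

(** The terms of [qe_rcf] have no inverses; the explicit abstraction over [term F] lets their
    coercion into [GRing.term F] apply. *)
Definition poly_over : pred (polyF F) := all (fun t : term F => term_over t).

(* The procedures of [qe_rcf] are in continuation-passing style: [c] stands for a
   case distinction whose branches return values of type [T]. *)
Definition cps_over T (P : T -> bool) (c : (T -> formula F) -> formula F) :=
  forall k : T -> formula F,
    (forall x, P x -> formula_over (k x)) -> formula_over (c k).

(* The only constants that the procedures of [qe_rcf] create are rational: the
   integers, and the entries [Coefs] of the inverses of integer matrices. *)
Hypothesis S_rat : forall q : rat, ratr q \in S.

Lemma mem0_over : 0 \in S. Proof. by rewrite -(rmorph0 (@ratr F)) S_rat. Qed.
Lemma mem1_over : 1 \in S. Proof. by rewrite -(rmorph1 (@ratr F)) S_rat. Qed.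
Lemma memN1_over : -1 \in S. Proof. by rewrite -(rmorphN1 (@ratr F)) S_rat. Qed.
Lemma mem_int_over z : z%:~R \in S. Proof. by rewrite -ratr_int S_rat. Qed.

(** The returned value is a natural number and carries no constant, whence [xpredT]. Constants can
    only enter through the tests that choose a branch, and these bear on the coefficients of [p]. *)
Lemma Size_over p : poly_over p -> cps_over xpredT (Size p).
Proof.
elim: p => [|c p IH] /= => [_ k kS|/andP[cS pS] k kS]; first exact: kS.
by apply: IH => // -[|n] _ /=; rewrite ?cS ?kS.
Qed.

Lemma Isnull_over p : poly_over p -> cps_over xpredT (Isnull p).
Proof. by move=> pS k kS; apply: Size_over => // n _; apply: kS. Qed.

Lemma LeadCoef_over p :
  poly_over p -> cps_over (fun t : term F => term_over t) (LeadCoef p).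
Proof.
elim: p => [|c p IH] /= => [_ k kS|/andP[cS pS] k kS]; first exact/kS/mem0_over.
by apply: IH => // t tS /=; rewrite tS !kS.
Qed.

(** * Arithmetic of formal polynomials *)

Lemma AmulXn_over (a : term F) n : term_over a -> poly_over (AmulXn a n).
Proof. by move=> aS; elim: n => [|n IH] /=; rewrite ?aS ?mem0_over. Qed.

Lemma AddPoly_over p q :
  poly_over p -> poly_over q -> poly_over (AddPoly p q).
Proof.
elim: p q => [|a p IH] [|b q] //= /andP[aS pS] /andP[bS qS].
by rewrite aS bS IH.
Qed.

Lemma ScalPoly_over (c : term F) p :
  term_over c -> poly_over p -> poly_over (ScalPoly c p).
Proof. by move=> cS; elim: p => //= a p IH /andP[-> /IH ->]; rewrite cS. Qed.

Lemma MulPoly_over p q :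
  poly_over p -> poly_over q -> poly_over (MulPoly p q).
Proof.
elim: p => //= a p IH /andP[aS pS] qS; apply: AddPoly_over.
  exact: ScalPoly_over.
by rewrite /= IH.
Qed.

Lemma ExpPoly_over p n : poly_over p -> poly_over (ExpPoly p n).
Proof.
move=> pS; case: n => [//|n]; rewrite /ExpPoly iteropS.
by elim: n => [|n IH] //=; apply: MulPoly_over.
Qed.

Lemma OppPoly_over p : poly_over p -> poly_over (OppPoly p).
Proof. by apply: ScalPoly_over; exact: memN1_over. Qed.

Lemma Deriv_over p : poly_over p -> poly_over (Deriv p).
Proof.
elim: p => //= a p IH /andP[aS pS]; apply: AddPoly_over => //=.
exact: IH.
Qed.

(** * Pseudo-division and greatest common divisors *)

Lemma Rediv_rec_loop_over q sq (cq : term F) c qq r n :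
    poly_over q -> term_over cq -> poly_over qq -> poly_over r ->
  cps_over (fun d => poly_over d.1.2 && poly_over d.2)
    (Rediv_rec_loop q sq cq c qq r n).
Proof.
move=> qS cqS; elim: n c qq r => [|n IH] c qq r qqS rS k kS /=.
  all: apply: Size_over => // m _; case: ifP => _; first by rewrite kS //= qqS.
  all: apply: LeadCoef_over => // l lS.
  (* Pseudo-division multiplies the quotient and the remainder by the leading coefficient [cq] of
     the divisor instead of dividing by it, so ring operations suffice. *)
  all: have mS := AmulXn_over (m - sq)%N lS.
  all: have cS : poly_over [:: cq] by rewrite /= cqS.
  all: have q1S := AddPoly_over (MulPoly_over qqS cS) mS.
  all: have r1S := AddPoly_over (MulPoly_over rS cS)
                     (OppPoly_over (MulPoly_over mS qS)).
  by apply: kS => /=; rewrite q1S r1S.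
exact: IH.
Qed.

Lemma Rediv_over p q : poly_over p -> poly_over q ->
  cps_over (fun d => poly_over d.1.2 && poly_over d.2) (Rediv p q).
Proof.
move=> pS qS k kS; apply: Isnull_over => // -[] _.
  by apply: kS; rewrite /= mem0_over.
apply: Size_over => // sq _; apply: Size_over => // sp _.
apply: LeadCoef_over => // l lS; apply: Rediv_rec_loop_over => //=.
by rewrite mem0_over.
Qed.

Lemma Rmod_over p q : poly_over p -> poly_over q ->
  cps_over poly_over (Rmod p q).
Proof.
move=> pS qS k kS; apply: Rediv_over => // d /andP[_ dS].
exact: kS.
Qed.

Lemma Rscal_over p q : poly_over p -> poly_over q ->
  cps_over xpredT (Rscal p q).
Proof. by move=> pS qS k kS; apply: Rediv_over => // d _; apply: kS. Qed.

Lemma Rgcd_loop_over n p q : poly_over p -> poly_over q ->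
  cps_over poly_over (Rgcd_loop n p q).
Proof.
elim: n p q => [|n IH] p q pS qS k kS /=.
  all: apply: Rmod_over => // r rS; apply: Isnull_over => // -[] _.
  all: try exact: kS.
exact: IH.
Qed.

Lemma Rgcd_over p q : poly_over p -> poly_over q ->
  cps_over poly_over (Rgcd p q).
Proof.
move=> pS qS k kS; apply: Size_over => // m _; apply: Size_over => // n _.
case: ifP => _; apply: Isnull_over => // -[] _; try exact: kS.
  all: by apply: Size_over => // l _; apply: Rgcd_loop_over.
Qed.

Lemma BigRgcd_over ps : all poly_over ps -> cps_over poly_over (BigRgcd ps).
Proof.
elim: ps => [|p ps IH] /= => [_ k kS|/andP[pS psS] k kS].
  by apply: kS; rewrite /= mem0_over.
by apply: IH => // r rS; apply: Rgcd_over.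
Qed.

(** * Sign changes and signed remainder sequences *)

Lemma Changes_over s : poly_over s -> cps_over xpredT (Changes s).
Proof.
elim: s => [|a s IH] /= => [_ k kS|/andP[aS sS] k kS]; first exact: kS.
apply: IH => // v _ /=; rewrite aS !kS //=.
by case: s sS => //= b s /andP[->].
Qed.

Lemma SeqPInfty_over ps : all poly_over ps -> cps_over poly_over (SeqPInfty ps).
Proof.
elim: ps => [|p ps IH] /= => [_ k kS|/andP[pS psS] k kS]; first exact: kS.
apply: LeadCoef_over => // l lS; apply: IH => // ls lsS.
by apply: kS; rewrite /= lS.
Qed.

(** The sign at minus infinity is that of the leading coefficient times a power of -1 given by the
    degree, which is why -1 must be an allowed constant. *)
Lemma SeqMInfty_over ps : all poly_over ps -> cps_over poly_over (SeqMInfty ps).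
Proof.
elim: ps => [|p ps IH] /= => [_ k kS|/andP[pS psS] k kS]; first exact: kS.
apply: LeadCoef_over => // l lS; apply: Size_over => // n _.
by apply: IH => // ls lsS; apply: kS; rewrite /= lS lsS memN1_over.
Qed.

Lemma ChangesPoly_over ps : all poly_over ps ->
  cps_over xpredT (ChangesPoly ps).
Proof.
move=> psS k kS; apply: SeqMInfty_over => // ms msS.
apply: SeqPInfty_over => // ls lsS.
by apply: Changes_over => // u _; apply: Changes_over => // v _; apply: kS.
Qed.

Lemma NextMod_over p q : poly_over p -> poly_over q ->
  cps_over poly_over (NextMod p q).
Proof.
move=> pS qS k kS; apply: LeadCoef_over => // l lS.
apply: Rscal_over => // m _; apply: Rmod_over => // r rS.
by apply: kS; apply: ScalPoly_over.
Qed.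

Lemma ModsAux_over p q n : poly_over p -> poly_over q ->
  cps_over (all poly_over) (ModsAux p q n).
Proof.
elim: n p q => [|n IH] p q pS qS k kS /=; first exact: kS.
apply: Isnull_over => // -[] _; first exact: kS.
apply: NextMod_over => // r rS; apply: IH => // ps psS.
by apply: kS; rewrite /= pS.
Qed.

Lemma Mods_over p q : poly_over p -> poly_over q ->
  cps_over (all poly_over) (Mods p q).
Proof.
move=> pS qS k kS; apply: Size_over => // m _; apply: Size_over => // n _.
exact: ModsAux_over.
Qed.

(** * Tarski queries and counting of roots under sign conditions *)

Lemma PolyComb_over sq sc : all poly_over sq -> poly_over (PolyComb sq sc).
Proof.
move=> sqS; rewrite /PolyComb.
elim: (iota _ _) => //= i s IH; apply: MulPoly_over => //.
apply: ExpPoly_over; have [/(all_nthP [::] sqS)//|lt_sq] := ltnP i (size sq).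
by rewrite nth_default.
Qed.

Lemma Pcq_over sq i : all poly_over sq -> poly_over (Pcq sq i).
Proof.
move=> sqS; rewrite /Pcq; elim: (sg_tab _) i => [|sc s IH] [|i] //=.
exact: PolyComb_over.
Qed.

(** The Tarski query, the sum of the signs of [q] at the roots of [p], is read off from the sign
    changes at both infinities along the signed remainder sequence of [p] and [p' * q]. *)
Lemma TaqR_over p q : poly_over p -> poly_over q -> cps_over xpredT (TaqR p q).
Proof.
move=> pS qS k kS; apply: Mods_over => // [|ps psS].
  by apply: MulPoly_over => //; apply: Deriv_over.
by apply: ChangesPoly_over => // z _; apply: kS.
Qed.

Lemma TaqsR_over p sq i : poly_over p -> all poly_over sq ->
  cps_over (fun t : term F => term_over t) (TaqsR p sq i).
Proof.
move=> pS sqS k kS; apply: TaqR_over => // [|z _]; first exact: Pcq_over.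
by apply: kS; apply: mem_int_over.
Qed.

(** The bounding polynomial is the derivative of the product of [sq]. By Rolle it has a root between
    any two consecutive roots of the product, so its roots probe the bounded intervals where all
    signs are constant. *)
Lemma BoundingPoly_over sq : all poly_over sq -> poly_over (BoundingPoly sq).
Proof.
move=> sqS; apply: Deriv_over; elim: sq sqS => //= p sq IH /andP[pS sqS].
by apply: MulPoly_over => //; apply: IH.
Qed.

(** These are entries of the inverse of an integer matrix, and matrix inversion commutes with the
    field embedding [ratr]. *)
Lemma coefs_rat n i : coefs F n i = ratr (coefs rat n i).
Proof.
have intrE : map_mx (intr : int -> F) (ctmat n) =
    map_mx (@ratr F) (map_mx intr (ctmat n)).
  by apply/matrixP => j k; rewrite !mxE ratr_int.
rewrite /coefs; set f := fun _ => _; set g := fun _ => _.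
have fg : f =1 ratr \o g.
  by move=> j; rewrite /f /g /= !castmxE intrE -map_invmx mxE.
rewrite (eq_map fg) (map_comp ratr g); move: (map g _) => s.
(* Beyond the end of the list both sides take the default value 0. *)
have [lt_i|le_i] := ltnP i (size s); first by rewrite (nth_map 0).
by rewrite !nth_default ?size_map ?rmorph0.
Qed.

Lemma Coefs_over n i : term_over (Coefs F n i : term F).
Proof.
case: n => [|[|n]] /=; last by rewrite coefs_rat S_rat.
  by case: eqP => _; rewrite ?mem0_over ?mem1_over.
(* For a single polynomial the coefficients are tabulated and involve only 0 and 1/2. *)
have S_half : 2%:R^-1 \in S by rewrite -(ratr_nat F) -fmorphV S_rat.
by case: i => [|[|[|i]]]; rewrite /= ?nth_nil ?mem0_over ?S_half.
Qed.

Lemma CcountWeak_over p sq : poly_over p -> all poly_over sq ->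
  cps_over (fun t : term F => term_over t) (CcountWeak p sq).
Proof.
(* The accumulator of the linear combination starts at 0 and is generalized for the induction. *)
move=> pS sqS k kS; rewrite /CcountWeak; move: (0%qfT) (isT : term_over 0%qfT).
elim: (3 ^ _)%N => [|i IH] s sS /=; first exact: kS.
apply: TaqsR_over => // x xS; apply: IH.
by apply/andP; split; first by apply/andP; split; last exact: Coefs_over.
Qed.

(** The equations are replaced by their gcd. If it is zero, the strict inequalities are tested at
    the roots of the bounding polynomial and, through leading coefficients, at plus and minus
    infinity; otherwise, at the roots of the gcd. *)
Lemma CcountGt0_over sp sq : all poly_over sp -> all poly_over sq ->
  formula_over (CcountGt0 sp sq).
Proof.
move=> spS sqS; apply: BigRgcd_over => // p pS.
apply: Isnull_over => // -[] _ /=.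
  apply: CcountWeak_over => // [|c cS /=]; first exact: BoundingPoly_over.
  apply/and3P; split=> //.
    elim: sq sqS => //= q sq IH /andP[qS sqS]; rewrite IH // andbT.
    by apply: LeadCoef_over.
  elim: sq sqS => //= q sq IH /andP[qS sqS]; rewrite IH // andbT.
  by apply: Size_over => // n _; apply: LeadCoef_over.
by apply: CcountWeak_over.
Qed.

(** * From root counting to elimination of quantifiers *)

Lemma to_rterm_over t : term_over t -> term_over (to_rterm t : term F).
Proof. by elim: t => //= u IHu v IHv /andP[/IHu -> /IHv]. Qed.

Lemma abstrX_over i (t : term F) : term_over t -> poly_over (abstrX i t).
Proof.
elim: t => //=.
- by move=> n _; case: ifP.
- by move=> x ->.
- move=> u IHu v IHv /andP[uS vS].
  by apply: AddPoly_over; [apply: IHu|apply: IHv].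
- by move=> u IHu uS; apply: OppPoly_over; apply: IHu.
- by move=> u IHu n uS; apply: ScalPoly_over => //; apply: IHu.
- move=> u IHu v IHv /andP[uS vS].
  by apply: MulPoly_over; [apply: IHu|apply: IHv].
- by move=> u IHu n uS; apply: ExpPoly_over; apply: IHu.
Qed.

Lemma wproj_over n (s : seq (GRing.term F) * seq (GRing.term F)) :
  all term_over s.1 -> all term_over s.2 -> formula_over (wproj n s).
Proof.
move=> s1 s2; apply: CcountGt0_over; rewrite all_map; apply/allP => t ts /=.
  by apply/abstrX_over/to_rterm_over/(allP s1).
by apply/abstrX_over/to_rterm_over/(allP s2).
Qed.

Definition oclause_over (c : ord.oclause F) :=
  all term_over (ord.terms_of_oclause c).

(** The normal form only recombines literals, and each atom becomes a condition on the difference of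
    its two sides. The flag [b] records a pending negation. *)
Lemma qf_to_odnf_over f b :
  formula_over f -> all oclause_over (ord.qf_to_odnf f b).
Proof.
have catS (s t : seq (ord.oclause F)) : all oclause_over s ->
  all oclause_over t -> all oclause_over (s ++ t) by rewrite all_cat => -> ->.
have andS (s t : seq (ord.oclause F)) : all oclause_over s ->
  all oclause_over t -> all oclause_over (ord.and_odnf s t).
  move=> sS tS; rewrite /ord.and_odnf; elim: s sS => [|c s IH] /=.
    by rewrite big_nil.
  rewrite big_cons => /andP[cS sS]; apply: catS; last exact: IH.
  rewrite all_map; apply/allP => d /(allP tS); move: cS.
  case: c d => [c1 c2 c3 c4] [d1 d2 d3 d4]; rewrite /oclause_over /= !all_cat.
  by do 2![case/and4P => -> -> -> ->].
elim: f b => //=.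
- by case=> [] [].
- by move=> u v [] /=; rewrite /oclause_over /= !andbT // andbC.
- by move=> u v [] /=; rewrite /oclause_over /= !andbT // andbC.
- by move=> u v [] /=; rewrite /oclause_over /= !andbT // andbC.
- by move=> u [].
- by move=> f IHf g IHg [] /andP[/IHf fS /IHg gS]; auto.
- by move=> f IHf g IHg [] /andP[/IHf fS /IHg gS]; auto.
- by move=> f IHf g IHg [] /andP[/IHf fS /IHg gS]; auto.
- by move=> f IHf b fS; apply: IHf.
- by move=> ? ? ? [].
- by move=> ? ? ? [].
Qed.

Lemma proj_over n c : oclause_over c ->
  formula_over (ord.proj (fun i s => wproj i s : ord.formula F) n c).
Proof.
move=> cS; rewrite /ord.proj /ord.oclause_to_w -map_comp.
have : all oclause_over (ord.oclause_neq_leq_elim c).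
  (* Splitting disequalities and weak inequalities into equations and strict inequalities adds only
     opposites of the disequality terms. *)
  apply/allP => d /ord.terms_of_neq_leq_elim dc; apply/allP => t /dc.
  rewrite mem_cat => /orP[/(allP cS)//|/mapP[u uc ->]] /=.
  apply: (allP cS); case: {cS dc} c uc => [c1 c2 c3 c4] /= uc.
  by rewrite !mem_cat uc orbT.
elim: (ord.oclause_neq_leq_elim c) => //= d s IH /andP[dS /IH ->].
case: d dS => [d1 d2 d3 d4]; rewrite /oclause_over /= !all_cat.
by case/and4P => d1S _ d3S _; rewrite wproj_over.
Qed.

Lemma quantifier_elim_over f : formula_over f ->
  formula_over (ord.quantifier_elim (fun i s => wproj i s : ord.formula F) f).
Proof.
have elimS n g : formula_over g -> formula_over (foldr ord.Or ord.False
    (map (ord.proj (fun i s => wproj i s : ord.formula F) n)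
      (ord.qf_to_odnf g false))).
  move=> /(qf_to_odnf_over false).
  by elim: (ord.qf_to_odnf g false) => //= c s IH /andP[/proj_over -> /IH].
elim: f => //=.
- by move=> f IHf g IHg /andP[/IHf -> /IHg].
- by move=> f IHf g IHg /andP[/IHf -> /IHg].
- by move=> f IHf g IHg /andP[/IHf -> /IHg].
- by move=> n f IHf /IHf; apply: elimS.
(* A universal quantifier is eliminated as the negation of an existential one. *)
- by move=> n f IHf /IHf fS; apply: (elimS n (ord.Not _)).
Qed.

End ConstantsIn.

Lemma qf_equiv_over (F : rcfType) (S : {pred F}) (f : ord.formula F) :
    (forall q : rat, ratr q \in S) -> ord.rformula f -> formula_over S f ->
  exists g : ord.formula F, [/\ ord.qf_form g, ord.rformula g, formula_over S g
    & forall e, ord.holds e f <-> ord.qf_eval e g].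
Proof.
move=> S_rat fr fS.
exists (ord.quantifier_elim (fun i s => wproj i s : ord.formula F) f).
have /andP[gq gr] := ord.quantifier_elim_wf (@wf_QE_wproj F) fr.
split=> //; first exact: quantifier_elim_over.
move=> e; apply: rwP.
exact: (ord.quantifier_elim_rformP (@wf_QE_wproj F) (@valid_QE_wproj F)).
Qed.

(** * Sets definable over the rationals *)

Definition rational (R : realType) : {pred R} :=
  fun x => `[< exists q : rat, x = ratr q >].

Lemma rational_ratr (R : realType) (q : rat) : ratr q \in @rational R.
Proof. by apply/asboolP; exists q. Qed.

Section Definable.

Variables (R : realType) (n : nat).
Implicit Types (t : R) (v : 'rV[R]_n) (vs : seq 'rV[R]_n) (k : nat).

Local Notation coords v := [seq v 0 i | i <- enum 'I_n].
(* The variable 'X_0 is [t], and 'X_(j * n + i).+1 is the i-th coordinate of the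
   j-th vector. *)
Definition env t vs : seq R := t :: flatten [seq coords v | v <- vs].

(** [GRing.rterm] excludes inverses, as the elimination procedure requires. Fixing the number [k] of
    vectors fixes the positions of their coordinates in the environment. *)
Definition term_definable k (g : R -> seq 'rV[R]_n -> R) :=
  exists T : GRing.term R, [/\ GRing.rterm T, term_over (@rational R) T &
    forall t vs, size vs = k -> GRing.eval (env t vs) T = g t vs].

Definition definable k (P : R -> seq 'rV[R]_n -> Prop) :=
  exists f : ord.formula R, [/\ ord.rformula f, formula_over (@rational R) f &
    forall t vs, size vs = k -> ord.holds (env t vs) f <-> P t vs].

Lemma size_coords v : size (coords v) = n.
Proof. by rewrite size_map size_enum_ord. Qed.

Lemma size_env t vs : size (env t vs) = (1 + size vs * n)%N.
Proof.
rewrite /= /env add1n; congr _.+1.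
by elim: vs => //= v vs IH; rewrite size_cat size_coords IH mulSn.
Qed.

Lemma env_rcons t vs v : env t (rcons vs v) = env t vs ++ coords v.
Proof. by rewrite /env map_rcons flatten_rcons. Qed.

Lemma nth_env t vs j (i : 'I_n) :
  (j < size vs)%N -> (env t vs)`_(j * n + i).+1 = vs`_j 0 i.
Proof.
rewrite /env /=; elim: vs j => //= v vs IH [|j] /= lt_j;
  rewrite nth_cat size_coords.
  by rewrite mul0n add0n ltn_ord (nth_map i) ?size_enum_ord // nth_ord_enum.
by rewrite mulSn -addnA ltnNge leq_addr /= addKn IH.
Qed.

(** * Definable functions *)

Lemma term_definable_scal k : term_definable k (fun t _ => t).
Proof. by exists (GRing.Var _ 0). Qed.

Lemma term_definable_coord k j i :
  (j < k)%N -> term_definable k (fun _ vs => vs`_j 0 i).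
Proof.
move=> lt_jk; exists (GRing.Var _ (j * n + i).+1); split=> // t vs vsk.
by rewrite -[LHS]/((env t vs)`_(j * n + i).+1) nth_env // vsk.
Qed.

Lemma term_definable_ratr k q : term_definable k (fun _ _ => ratr q).
Proof. by exists (GRing.Const (ratr q)); split=> //=; apply: rational_ratr. Qed.

Lemma term_definable0 k : term_definable k (fun _ _ => 0).
Proof. by exists (GRing.NatConst _ 0). Qed.

Lemma term_definableD k g h : term_definable k g -> term_definable k h ->
  term_definable k (fun t vs => g t vs + h t vs).
Proof.
move=> [T [Tr TS TE]] [U [Ur US UE]]; exists (GRing.Add T U).
by split=> /= [||t vs vsk]; rewrite ?Tr ?TS // TE ?UE.
Qed.

Lemma term_definableM k g h : term_definable k g -> term_definable k h ->
  term_definable k (fun t vs => g t vs * h t vs).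
Proof.
move=> [T [Tr TS TE]] [U [Ur US UE]]; exists (GRing.Mul T U).
by split=> /= [||t vs vsk]; rewrite ?Tr ?TS // TE ?UE.
Qed.

Lemma term_definableN k g :
  term_definable k g -> term_definable k (fun t vs => - g t vs).
Proof.
move=> [T [Tr TS TE]]; exists (GRing.Opp T).
by split=> //= t vs vsk; rewrite TE.
Qed.

Lemma term_definableX k g m :
  term_definable k g -> term_definable k (fun t vs => g t vs ^+ m).
Proof.
move=> [T [Tr TS TE]]; exists (GRing.Exp T m).
by split=> //= t vs vsk; rewrite TE.
Qed.

Lemma term_definable_sum k (I : Type) (r : seq I) g :
    (forall i, term_definable k (g i)) ->
  term_definable k (fun t vs => \sum_(i <- r) g i t vs).
Proof.
move=> gk; elim: r => [|i r [T [Tr TS TE]]].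
  by exists (GRing.NatConst _ 0); split=> // t vs _; rewrite big_nil.
have [U [Ur US UE]] := gk i; exists (GRing.Add U T).
by split=> /= [||t vs vsk]; rewrite ?Ur ?US // big_cons TE ?UE.
Qed.

Lemma term_definable_prod k (I : Type) (r : seq I) g :
    (forall i, term_definable k (g i)) ->
  term_definable k (fun t vs => \prod_(i <- r) g i t vs).
Proof.
move=> gk; elim: r => [|i r [T [Tr TS TE]]].
  by exists (GRing.NatConst _ 1); split=> // t vs _; rewrite big_nil.
have [U [Ur US UE]] := gk i; exists (GRing.Mul U T).
by split=> /= [||t vs vsk]; rewrite ?Ur ?US // big_cons TE ?UE.
Qed.

Lemma term_definable_eq k g h : (forall t vs, size vs = k -> g t vs = h t vs) ->
  term_definable k g -> term_definable k h.
Proof.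
move=> gh [T [Tr TS TE]]; exists T; split=> // t vs vsk.
by rewrite TE // gh.
Qed.

(** The polynomial is expanded over its support, a fixed list of monomials, so that its value is a
    finite sum of products of rational constants and powers of coordinates. *)
Lemma term_definable_meval k j (p : mpoly.mpoly n rat) : (j < k)%N ->
  term_definable k (fun _ vs =>
    mpoly.meval (fun i => vs`_j 0 i) (mpoly.map_mpoly ratr p)).
Proof.
move=> lt_jk; refine (@term_definable_eq k (fun _ vs =>
  \sum_(m <- mpoly.msupp p) ratr (mpoly.mcoeff m p) *
    \prod_(i <- index_enum 'I_n) vs`_j 0 i ^+ mpoly.fun_of_multinom m i) _ _ _).
  move=> t vs vsk; rewrite [RHS]raddf_sum /=; apply: eq_bigr => m _.
  rewrite mpoly.mevalM mpoly.mevalC rmorph_prod; congr (_ * _).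
  by apply: eq_bigr => i _; rewrite rmorphXn /= mpoly.mevalXU.
apply: term_definable_sum => m; apply: term_definableM.
  exact: term_definable_ratr.
apply: term_definable_prod => i; apply: term_definableX.
exact: term_definable_coord.
Qed.

(** * Definable relations *)

Lemma definable_iff k P Q : (forall t vs, size vs = k -> P t vs <-> Q t vs) ->
  definable k P -> definable k Q.
Proof.
move=> PQ [f [fr fS fP]]; exists f; split=> // t vs vsk.
by rewrite fP // PQ.
Qed.

Lemma definable_eq k g h : term_definable k g -> term_definable k h ->
  definable k (fun t vs => g t vs = h t vs).
Proof.
move=> [T [Tr TS TE]] [U [Ur US UE]]; exists (ord.Equal T U).
by split=> /= [||t vs vsk]; rewrite ?Tr ?TS // TE ?UE.
Qed.

Lemma definable_le k g h : term_definable k g -> term_definable k h ->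
  definable k (fun t vs => g t vs <= h t vs).
Proof.
move=> [T [Tr TS TE]] [U [Ur US UE]]; exists (ord.Le T U).
by split=> /= [||t vs vsk]; rewrite ?Tr ?TS // TE ?UE.
Qed.

Lemma definable_not k P : definable k P -> definable k (fun t vs => ~ P t vs).
Proof.
move=> [f [fr fS fP]]; exists (ord.Not f); split=> //= t vs vsk.
by rewrite fP.
Qed.

Lemma definable_and k P Q : definable k P -> definable k Q ->
  definable k (fun t vs => P t vs /\ Q t vs).
Proof.
move=> [f [fr fS fP]] [g [gr gS gQ]]; exists (ord.And f g).
by split=> /= [||t vs vsk]; rewrite ?fr ?fS // fP ?gQ.
Qed.

Lemma definable_imply k P Q : definable k P -> definable k Q ->
  definable k (fun t vs => P t vs -> Q t vs).
Proof.
move=> [f [fr fS fP]] [g [gr gS gQ]]; exists (ord.Implies f g).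
by split=> /= [||t vs vsk]; rewrite ?fr ?fS // fP ?gQ.
Qed.

(** Quantification over a finite index type is encoded as a finite conjunction. *)
Lemma definable_forall_fin k (I : finType) P :
  (forall i : I, definable k (P i)) ->
  definable k (fun t vs => forall i, P i t vs).
Proof.
move=> Pk; suff [f [fr fS fP]] : definable k
    (fun t vs => forall i, i \in enum I -> P i t vs).
  exists f; split=> // t vs vsk; rewrite fP //.
  by split=> H i; [apply: H; rewrite mem_enum | move=> _; apply: H].
elim: (enum I) => [|i r [f [fr fS fP]]]; first by exists (ord.Bool true).
have [g [gr gS gP]] := Pk i; exists (ord.And g f).
split=> /= [||t vs vsk]; rewrite ?gr ?gS // gP // fP //; split=> [[Pi Pr] l|H].
  by rewrite inE => /orP[/eqP ->//|]; apply: Pr.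
by split=> [|l lr]; apply: H; rewrite inE ?eqxx ?lr ?orbT.
Qed.

(** Quantifying over a vector takes one real quantifier per coordinate. Since the bound variables
    are numbered from the length [m] of the environment, each assignment appends a value to it. *)
Lemma holds_exists_block m p (f : ord.formula R) : exists g : ord.formula R,
  [/\ ord.rformula g = ord.rformula f,
      formula_over (@rational R) g = formula_over (@rational R) f &
      forall s : seq R, size s = m ->
        ord.holds s g <-> exists2 w, size w = p & ord.holds (s ++ w) f].
Proof.
elim: p m => [|p IH] m.
  exists f; split=> // s _.
  split=> [fs|[w /size0nil ->]]; last by rewrite cats0.
  by exists [::]; rewrite ?cats0.
have [g [gr gS gE]] := IH m.+1; exists (ord.Exists m g); split=> // s sm /=.
have set_s x : set_nth 0 s m x = rcons s x.
  by rewrite -sm set_nthE ltnn subnn cats1.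
split=> [[x]|[[//|x w] [wp] sw]].
  rewrite set_s gE ?size_rcons ?sm // => -[w wp]; rewrite cat_rcons.
  by exists (x :: w) => //=; rewrite wp.
by exists x; rewrite set_s gE ?size_rcons ?sm //; exists w; rewrite ?cat_rcons.
Qed.

Lemma definable_exists k P : definable k.+1 P ->
  definable k (fun t vs => exists v, P t (rcons vs v)).
Proof.
move=> [f [fr fS fP]].
(* The new block starts after the scalar and the coordinates of the [k] vectors. *)
have [g [gr gS gE]] := holds_exists_block (1 + k * n) n f.
exists g; rewrite gr gS; split=> // t vs vsk.
rewrite gE ?size_env ?vsk //; split=> [[w wn]|[v]].
  have -> : w = coords (\row_i w`_i).
    apply: (@eq_from_nth _ 0); rewrite ?size_coords // wn => i lt_in.
    rewrite (nth_map (Ordinal lt_in)) ?size_enum_ord // mxE.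
    by rewrite nth_enum_ord.
  by rewrite -env_rcons fP ?size_rcons ?vsk //; exists (\row_i w`_i).
rewrite -fP ?size_rcons ?vsk // env_rcons => fv.
by exists (coords v); rewrite ?size_coords.
Qed.

Lemma definable_forall k P : definable k.+1 P ->
  definable k (fun t vs => forall v, P t (rcons vs v)).
Proof.
move=> /definable_not/definable_exists/definable_not; apply: definable_iff.
by move=> t vs _; split=> [/forallNP + v|H [v]]; [move/(_ v)/contrapT | apply].
Qed.

End Definable.

(** * Infima of definable sets of reals *)

Section RealAlgebraic.

Variable R : realType.

Lemma eval_term_poly (T : GRing.term R) :
    GRing.rterm T -> term_over (@rational R) T ->
  exists p : {poly rat},
    forall t, GRing.eval [:: t] T = (map_poly ratr p).[t].
Proof.
elim: T => //=.
- move=> [|i] _ _; first by exists 'X => t; rewrite map_polyX hornerX.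
  (* Any variable but the first lies outside the environment [[:: t]] and evaluates to 0. *)
  by exists 0 => t; rewrite map_poly0 horner0; case: i.
- by move=> x _ /asboolP[q ->]; exists q%:P => t; rewrite map_polyC hornerC.
- move=> m _ _; exists m%:R => t.
  by rewrite rmorph_nat -polyC_natr hornerC.
- move=> T IHT U IHU /andP[Tr Ur] /andP[TS US].
  have [p pT] := IHT Tr TS; have [q qU] := IHU Ur US.
  by exists (p + q) => t; rewrite rmorphD hornerD pT qU.
- move=> T IHT Tr TS; have [p pT] := IHT Tr TS.
  by exists (- p) => t; rewrite rmorphN hornerN pT.
- move=> T IHT m Tr TS; have [p pT] := IHT Tr TS.
  by exists (p *+ m) => t; rewrite rmorphMn hornerMn pT.
- move=> T IHT U IHU /andP[Tr Ur] /andP[TS US].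
  have [p pT] := IHT Tr TS; have [q qU] := IHU Ur US.
  by exists (p * q) => t; rewrite rmorphM hornerM pT qU.
- move=> T IHT m Tr TS; have [p pT] := IHT Tr TS.
  by exists (p ^+ m) => t; rewrite rmorphXn horner_exp pT.
Qed.

Lemma near_sg_poly (p : {poly R}) (t0 : R) : p.[t0] != 0 ->
  \forall t \near t0, Num.sg p.[t] = Num.sg p.[t0].
Proof.
move=> pt0; have pc := @continuous_horner R p t0.
have [pt0_gt0|pt0_lt0|/eqP] := ltgtP 0 p.[t0];
  last by rewrite eq_sym (negbTE pt0).
  near=> t; rewrite !gtr0_sg //; near: t.
  exact: (cvgr_gt _ pc _ pt0_gt0).
near=> t; rewrite !ltr0_sg //; near: t.
exact: (cvgr_lt _ pc _ pt0_lt0).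
Unshelve. all: by end_near. Qed.

(** The term is a rational polynomial in [t]. Either it is zero, and the sign is constant, or it
    does not vanish at the transcendental [t0], and continuity applies. *)
Lemma near_sg_transcendental (T : GRing.term R) (t0 : R) :
    ~ algebraicOver (@ratr R) t0 ->
    GRing.rterm T -> term_over (@rational R) T ->
  \forall t \near t0,
    Num.sg (GRing.eval [:: t] T) = Num.sg (GRing.eval [:: t0] T).
Proof.
move=> t0_tr Tr TS; have [p pT] := eval_term_poly Tr TS.
have [p0|p_neq0] := eqVneq p 0.
  by near=> t; rewrite !pT p0 map_poly0 !horner0.
have pt0 : (map_poly ratr p).[t0] != 0.
  by apply/negP => pt0; apply: t0_tr; exists p.
near=> t; rewrite !pT; near: t; exact: near_sg_poly.
Unshelve. all: by end_near. Qed.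

Lemma near_qf_eval_transcendental (g : ord.formula R) (t0 : R) :
    ~ algebraicOver (@ratr R) t0 ->
    ord.rformula g -> formula_over (@rational R) g ->
  \forall t \near t0, ord.qf_eval [:: t] g = ord.qf_eval [:: t0] g.
Proof.
move=> t0_tr.
(* The truth of an atom relating [T] and [U] depends only on the sign of [U - T]. *)
have sub_sg T U : GRing.rterm T && GRing.rterm U ->
    term_over (@rational R) T && term_over (@rational R) U ->
    \forall t \near t0,
      Num.sg (GRing.eval [:: t] U - GRing.eval [:: t] T) =
      Num.sg (GRing.eval [:: t0] U - GRing.eval [:: t0] T).
  move=> /andP[Tr Ur] /andP[TS US].
  by apply: (near_sg_transcendental (T := GRing.Add U (GRing.Opp T))) => //=;
    rewrite ?Tr ?Ur ?TS ?US.
elim: g => //=.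
- by move=> b _ _; near=> t.
- move=> T U TUr TUS; have := sub_sg T U TUr TUS; apply: filterS => t sgE.
  by rewrite eq_sym -subr_eq0 -sgr_eq0 sgE sgr_eq0 subr_eq0 eq_sym.
- move=> T U TUr TUS; have := sub_sg T U TUr TUS; apply: filterS => t sgE.
  by rewrite -subr_gt0 -sgr_gt0 sgE sgr_gt0 subr_gt0.
- move=> T U TUr TUS; have := sub_sg T U TUr TUS; apply: filterS => t sgE.
  by rewrite -subr_ge0 -sgr_ge0 sgE sgr_ge0 subr_ge0.
- move=> f IHf g IHg /andP[fr gr] /andP[fS gS]; near=> t.
  congr (_ && _); near: t.
    exact: IHf.
  exact: IHg.
- move=> f IHf g IHg /andP[fr gr] /andP[fS gS]; near=> t.
  congr (_ || _); near: t.
    exact: IHf.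
  exact: IHg.
- move=> f IHf g IHg /andP[fr gr] /andP[fS gS]; near=> t.
  congr (_ ==> _); near: t.
    exact: IHf.
  exact: IHg.
- by move=> f IHf fr fS; near=> t; congr (~~ _); near: t; exact: IHf.
(* On a quantified formula the value of [qf_eval] does not depend on the environment. *)
- by move=> i f _ _ _; near=> t.
- by move=> i f _ _ _; near=> t.
Unshelve. all: by end_near. Qed.

Lemma inf_definable_algebraic n (P : R -> seq 'rV[R]_n -> Prop) (A : set R) :
    definable 0 P -> (forall t, A t <-> P t [::]) ->
    has_inf A -> algebraicOver (@ratr R) (inf A).
Proof.
move=> [f [fr fS fP]] AP infA; apply: contrapT => A_tr.
have [g [gq gr gS fg]] := qf_equiv_over (@rational_ratr R) fr fS.
have Ag t : A t <-> ord.qf_eval [:: t] g by rewrite AP -fP // -fg.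
have /nbhs_ballP[e /= e_gt0 eP] := near_qf_eval_transcendental A_tr gr gS.
have [a Aa a_lt] := inf_adherent e_gt0 infA.
have inf_le x : A x -> inf A <= x by apply/ge_inf; case: infA.
(* The ball around the infimum contains the point [a] of [A], and membership in [A] is constant on
   this ball. *)
have A_inf : A (inf A).
  apply/Ag; rewrite -(eP a); first exact/Ag.
  by rewrite /ball /= ltr_distlC; have := inf_le _ Aa; lra.
(* By the same constancy [A] has a point below its infimum, which is absurd. *)
have : A (inf A - e / 2).
  apply/Ag; rewrite (eP (inf A - e / 2)); first exact/Ag.
  by rewrite /ball /= ltr_distlC; lra.
by move/inf_le; lra.
Qed.

End RealAlgebraic.

(** * The reach *)

Section Reach.

Variables (R : realType) (n s : nat) (f : 'I_s -> mpoly.mpoly n rat).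

Local Notation X := (real_zeros R f).
Local Notation edist := Defs.edist.
(** Unlike [edist], this is a polynomial in the coordinates and can be written as a term. *)
Definition sqdist (x y : 'rV[R]_n) : R := \sum_(i < n) (x 0 i - y 0 i) ^+ 2.

Lemma sqdist_ge0 x y : 0 <= sqdist x y.
Proof. by apply: sumr_ge0 => i _; apply: sqr_ge0. Qed.

Lemma edist_le x y z u : (edist x y <= edist z u) = (sqdist x y <= sqdist z u).
Proof. by rewrite ler_sqrt ?sqdist_ge0. Qed.

(** The square root is characterized by polynomial conditions, which makes the distance relation
    definable. *)
Lemma edistP d x y : d = edist x y <-> 0 <= d /\ d ^+ 2 = sqdist x y.
Proof.
split=> [->|[d_ge0 d2]]; first by rewrite sqrtr_ge0 sqr_sqrtr ?sqdist_ge0.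
by rewrite /edist -[\sum_(_ < _) _]/(sqdist x y) -d2 sqrtr_sqr ger0_norm.
Qed.

Lemma term_definable_sqdist k i j : (i < k)%N -> (j < k)%N ->
  @term_definable R n k (fun _ vs => sqdist vs`_i vs`_j).
Proof.
move=> ik jk; apply: term_definable_sum => l; apply: term_definableX.
apply: term_definableD; first exact: term_definable_coord.
by apply: term_definableN; apply: term_definable_coord.
Qed.

Lemma definable_real_zeros k i : (i < k)%N -> definable k (fun _ vs => X vs`_i).
Proof.
move=> ik; apply: definable_forall_fin => j; apply: definable_eq.
  exact: term_definable_meval.
exact: term_definable0.
Qed.

Lemma definable_nearest_point k i j : (i < k)%N -> (j < k)%N ->
  definable k (fun _ vs => nearest_point X vs`_i vs`_j).
Proof.
move=> ik jk; apply: definable_and; first exact: definable_real_zeros.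
(* The competing point [z] is appended at index [k], and distances are compared through their
   squares. *)
apply: (@definable_iff _ _ _ (fun _ vs => forall z,
  X (rcons vs z)`_k -> sqdist (rcons vs z)`_j (rcons vs z)`_i <=
                       sqdist (rcons vs z)`_k (rcons vs z)`_i)).
  move=> t vs vsk; split=> H z; have := H z;
    by rewrite !nth_rcons vsk ik jk ltnn eqxx edist_le.
apply: (@definable_forall _ _ _ (fun _ vs =>
  X vs`_k -> sqdist vs`_j vs`_i <= sqdist vs`_k vs`_i)).
apply: definable_imply; first exact: definable_real_zeros.
by apply: definable_le; apply: term_definable_sqdist => //; apply: ltnW.
Qed.

Lemma definable_neq k i j : (i < k)%N -> (j < k)%N ->
  @definable R n k (fun _ vs => vs`_i <> vs`_j).
Proof.
move=> ik jk; apply: definable_not.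
apply: (@definable_iff _ _ _ (fun _ vs => forall l, vs`_i 0 l = vs`_j 0 l)).
  by move=> t vs _; split=> [/rowP|->].
apply: definable_forall_fin => l.
by apply: definable_eq; apply: term_definable_coord.
Qed.

Lemma definable_reach_dist : @definable R n 0 (fun t _ =>
  exists x u, [/\ X x, medial_axis X u & t = edist x u]).
Proof.
(* The vectors are, in order, the point of [X], the point of the medial axis, and two distinct
   nearest points that witness its membership there. *)
pose B t (vs : seq 'rV[R]_n) := X vs`_0 /\ vs`_2 <> vs`_3 /\
  nearest_point X vs`_1 vs`_2 /\ nearest_point X vs`_1 vs`_3 /\
  0 <= t /\ t ^+ 2 = sqdist vs`_0 vs`_1.
have B_def : definable 4 B.
  apply: definable_and; first exact: definable_real_zeros.
  apply: definable_and; first exact: definable_neq.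
  apply: definable_and; first exact: definable_nearest_point.
  apply: definable_and; first exact: definable_nearest_point.
  apply: definable_and.
    apply: definable_le; first exact: term_definable0.
    exact: term_definable_scal.
  apply: definable_eq; last exact: term_definable_sqdist.
  exact/term_definableX/term_definable_scal.
(* The vectors are quantified from the last to the first, leaving only the scalar free. *)
do 4!move/definable_exists: B_def => B_def.
apply: definable_iff B_def => t [|//] _; split.
  case=> x [u [y [z [/= Xx [yz [uy [uz /edistP tE]]]]]]].
  by exists x, u; split=> //; exists y, z.
by case=> x [u [Xx [y [z [yz uy uz]]] /edistP tE]]; exists x, u, y, z.
Qed.

End Reach.

Theorem proposition3p14 (R : realType) (n s : nat)
    (f : 'I_s -> mpoly.mpoly n rat)
    (manifoldX : is_submanifold (real_zeros R f))
    (medial_neq0 : medial_axis (real_zeros R f) !=set0) :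
  exists2 t : R, reach (real_zeros R f) = t%:E & algebraicOver (@ratr R) t.
Proof.
set A := [set t : R | exists x u,
  [/\ real_zeros R f x, medial_axis (real_zeros R f) u & t = Defs.edist x u]].
have A_neq0 : A !=set0.
  (* A nearest point of a medial axis point lies in [X] and so yields an element of [A]. *)
  have [u [x [y [xy ux uy]]]] := medial_neq0.
  by exists (Defs.edist x u), x, u; split=> //; [case: ux | exists x, y].
have A_lb : has_lbound A by exists 0 => _ [x [u [_ _ ->]]]; apply: sqrtr_ge0.
exists (inf A).
  (* As [A] is nonempty and bounded below by 0, its infimum in the extended reals is the real number
     [inf A]. *)
  rewrite -ereal_inf_EFin //; congr ereal_inf; apply/seteqP; split=> d.
    by case=> x [u [Xx Mu ->]]; exists (Defs.edist x u) => //; exists x, u.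
  by case=> _ [x [u [Xx Mu ->]]] <-; exists x, u.
by apply: (inf_definable_algebraic (definable_reach_dist R f)).
Qed.
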